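(* Let $\{S(t): t\ge 0\}$ be a semigroup on a nonempty subset $V$ of a normed space $(X,\|\cdot\|_X)$ over $\mathbb{K}\in\{\mathbb{R},\mathbb{C}\}$ and let $B$ be a nonempty bounded subset of $V$ such that $S(T)B\subseteq B$, where $T>0$. Assume that the semigroup satisfies the generalized squeezing property on $B$ at time $T$ with parameters $(n,\eta,\mu,\kappa)$ (with associated map $P:V\to X_n$). Then for any $\sigma\in(0,1-\eta)$ there exist $k_0\in\mathbb{N}$, $a,b>0$ and $h\ge 1$ such that the covering condition $$N^{V}(S(kT)B,aq^{k})\le b h^{k},\quad k\in\mathbb{N},\ k\ge k_0,$$ holds with $q=\eta+\sigma$ and $$h\le\left(1+\tfrac{2\kappa\mu\, d_{BM}(X_n,\ell^n_2)}{\sigma}\right)^{\mathbf{n}},\qquad\text{where } \mathbf{n}=\begin{cases}n&\text{if }\mathbb{K}=\mathbb{R},\\2n&\text{if }\mathbb{K}=\mathbb{C}.\end{cases}$$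
   Context: $\mathbb{N}=\{1,2,\dots\}$. $V$ carries the metric $d(x,y)=\|x-y\|_X$. A semigroup $\{S(t):t\ge0\}$ on $V$ is a family of (not necessarily linear) maps $S(t):V\to V$ with $S(t)S(s)=S(t+s)$ for $t,s\ge 0$ and $S(0)=I$; ''$t\ge 0$'' means throughout either $t\in[0,\infty)$ or $t\in\mathbb{N}\cup\{0\}$ (and $T$ belongs to the time set). Generalized squeezing property on $B\subseteq V$ at time $T>0$ with parameters $(n,\eta,\mu,\kappa)$: there exist a map $P:V\to X_n$ (possibly nonlinear) with values in a normed space $(X_n,\|\cdot\|_{X_n})$ over $\mathbb{K}$ of dimension $n\in\mathbb{N}$ and constants $\eta\in[0,1)$, $\mu>0$, $\kappa>0$ such that for all $x,y\in B$ $$\|S(T)x-S(T)y\|_X\le\eta\|x-y\|_X+\mu\|PS(T)x-PS(T)y\|_{X_n},\qquad \|PS(T)x-PS(T)y\|_{X_n}\le\kappa\|x-y\|_X.$$ $\ell_2^n$ is $\mathbb{K}^n$ with the Euclidean norm, and the multiplicative Banach–Mazur distance is $d_{BM}(X_n,\ell^n_2)=\inf\{\|\Lambda\|_{\mathcal{L}(X_n,\ell^n_2)}\|\Lambda^{-1}\|_{\mathcal{L}(\ell^n_2,X_n)}:\Lambda:X_n\to\ell^n_2\text{ a linear isomorphism}\}$. $N^V(G,\varepsilon)$ is the minimal number of open $\varepsilon$-balls in $V$ centered at points of $G$ needed to cover $G$. *)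

(* Defs.v *)
From HB Require Import structures.
From mathcomp Require Export all_boot all_order all_algebra.
From mathcomp Require Export complex.
From mathcomp Require Export all_classical all_reals all_analysis.
Export numFieldNormedType.Exports.
Export Order.TTheory GRing.Theory Num.Theory.

Set Implicit Arguments.
Unset Strict Implicit.
Unset Printing Implicit Defensive.

Local Open Scope classical_set_scope.
Local Open Scope ring_scope.

Inductive scalars := RealScalars | ComplexScalars.

Definition scalar_field (R : realType) (k : scalars) : numFieldType :=
  match k with
  | RealScalars => R : numFieldType
  | ComplexScalars => R[i] : numFieldType
  end.

Definition real_dim (k : scalars) (n : nat) : nat :=
  match k with RealScalars => n | ComplexScalars => (2 * n)%N end.

Definition scalar_re (R : realType) (k : scalars) : scalar_field R k -> R :=
  match k return scalar_field R k -> R with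
  | RealScalars => fun x => x
  | ComplexScalars => fun x => complex.Re x
  end.

(* The library norm of a normed space over R[i] takes its values in R[i], in
   the nonnegative reals; rnorm is the same norm with values in R. *)
Definition rnorm (R : realType) (k : scalars)
    (E : normedModType (scalar_field R k)) (x : E) : R :=
  scalar_re `|x|.

Definition l2norm (R : realType) (k : scalars) (n : nat)
    (v : 'rV[scalar_field R k]_n) : R :=
  Num.sqrt (\sum_(i < n) (scalar_re `|v 0 i|) ^+ 2).

(* The set is bounded for linear maps between finite-dimensional spaces, which
   is the only case in which op_norm is used. *)
Definition op_norm (R : realType) (U W : Type) (normU : U -> R)
    (normW : W -> R) (f : U -> W) : R :=
  sup [set normW (f x) | x in [set x | normU x <= 1]].

Definition has_dim (K : numFieldType) (E : lmodType K) (n : nat) : Prop :=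
  exists L : {linear E -> 'rV[K]_n}, bijective L.

(* For E of dimension n, so that the set is nonempty; it is bounded below by 0. *)
Definition banach_mazur_l2 (R : realType) (k : scalars)
    (E : normedModType (scalar_field R k)) (n : nat) : R :=
  inf [set r : R | exists (L : {linear E -> 'rV[scalar_field R k]_n})
                          (L' : 'rV[scalar_field R k]_n -> E),
    [/\ cancel L L', cancel L' L
      & r = op_norm (@rnorm R k E) (@l2norm R k n) L
            * op_norm (@l2norm R k n) (@rnorm R k E) L'] ].

Section metric_subset.
Variables (R : realType) (k : scalars) (X : normedModType (scalar_field R k)).
Variable V : set X.

Definition dist (x y : V) : R := rnorm (val x - val y).

(* Value +oo when no finite cover exists. *)
Definition covering_number (G : set V) (eps : R) : \bar R :=
  ereal_inf [set m%:R%:E | m in [set m : nat | exists c : 'I_m -> V,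
    (forall i, G (c i)) /\
    G `<=` \bigcup_i [set y | dist (c i) y < eps] ] ].

Definition time_set (TT : set R) : Prop :=
  TT = [set t | 0 <= t] \/ TT = range (fun j : nat => j%:R).

(* S is only constrained at times belonging to TT. *)
Definition semigroup (TT : set R) (S : R -> V -> V) : Prop :=
  (forall x, S 0 x = x) /\
  (forall t s, TT t -> TT s -> forall x, S t (S s x) = S (t + s) x).

Definition generalized_squeezing (S : R -> V -> V) (B : set V) (T : R)
    (Xn : normedModType (scalar_field R k)) (P : V -> Xn)
    (n : nat) (eta mu kappa : R) : Prop :=
  [/\ (0 < n)%N /\ has_dim Xn n,
      0 <= eta < 1, 0 < mu, 0 < kappa
    & forall x y, B x -> B y ->
        dist (S T x) (S T y)
          <= eta * dist x y + mu * rnorm (P (S T x) - P (S T y)) /\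
        rnorm (P (S T x) - P (S T y)) <= kappa * dist x y].

End metric_subset.

(* Main.v *)
From mathcomp Require Import finmap ring lra zify.
Require Import Defs.

(* Put q = eta + sigma, let d bound the diameter of B, let m be the real dimension
   of X_n and H = (1 + 2 kappa mu / sigma)^m.  If E is a finite subset of B of
   diameter at most d with dist (S(jT)x) (S(jT)y) > q^j d for distinct x, y in E,
   then E has at most H^j points, by induction on j.  Indeed P S(T) E lies in a
   ball of radius kappa d, and for u in X_n the points x of E with
   |P S(T) x - u| < r := sigma d / (2 mu) are mapped by S(T) to a set of diameter
   at most q d, so that there are at most H^(j-1) of them.  Averaging over u in a
   ball of radius kappa d + r bounds the size of E by H^(j-1) times the volume
   ratio ((kappa d + r) / r)^m = H.  A maximal such E gives the cover, with the
   factor 1 in place of the Banach-Mazur distance, which is at least 1.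
   Volumes are replaced by numbers of points of fine lattices. *)

Set Implicit Arguments.
Unset Strict Implicit.
Unset Printing Implicit Defensive.

Local Open Scope classical_set_scope.
Local Open Scope ring_scope.

(** * Norms on real coordinate space and polynomially bounded growth *)

Definition is_norm (R : realType) (m : nat) (nu : 'rV[R]_m -> R) : Prop :=
  [/\ forall u v, nu (u + v) <= nu u + nu v,
      forall a v, nu (a *: v) = `|a| * nu v
    & forall v, nu v = 0 -> v = 0].

(** On [0, 1] a convex function lies below its chord. *)
Lemma expr_1D_ub (R : realFieldType) (m : nat) (e : R) :
  0 <= e <= 1 -> (1 + e) ^+ m <= 1 + (2 ^+ m - 1) * e.
Proof.
move=> /andP[e0 e1]; elim: m => [|m IH]; first by rewrite !expr0; lra.
rewrite !exprS; have p1 : 1 <= (2 : R) ^+ m by rewrite exprn_ege1 ?ler1n.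
have := ler_wpM2l (_ : 0 <= 1 + e) IH; move=> /(_ ltac:(lra)) /le_trans; apply.
have : 0 <= ((2 : R) ^+ m - 1) * (e * (1 - e)) by rewrite !mulr_ge0//; lra.
nra.
Qed.

Lemma expr_1D_lb (R : realFieldType) (j : nat) (e : R) :
  0 <= e -> 1 + j%:R * e <= (1 + e) ^+ j.
Proof.
move=> e0; elim: j => [|j IH]; first by rewrite !expr0; lra.
rewrite exprS -natr1; have := ler_wpM2l (_ : 0 <= 1 + e) IH.
move=> /(_ ltac:(lra)) /(le_trans _); apply.
have : 0 <= j%:R * (e * e) by rewrite !mulr_ge0.
nra.
Qed.

Lemma expr_unbounded (R : realType) (g C : R) : 1 < g -> exists j, C < g ^+ j.
Proof.
move=> g1; pose e := g - 1; have e0 : 0 < e by rewrite subr_gt0.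
have -> : g = 1 + e by rewrite /e; lra.
exists (Num.truncn (C / e)).+1.
apply: (lt_le_trans _ (expr_1D_lb _ (ltW e0))).
have : C / e < (Num.truncn (C / e)).+1%:R by exact: truncnS_gt.
rewrite ltr_pdivrMr// => ?; lra.
Qed.

(* Otherwise v would grow by a factor larger than [lam' ^+ m] under dilation by
   some [lam' > lam], contradicting the growth bound. *)
Lemma polynomial_growth_ratio (R : realType) (m : nat) (v : R -> R)
    (C c lam del : R) :
  {homo v : x y / x <= y} -> (forall t, 0 < t -> 1 <= v t) ->
  (forall t, 0 <= t -> v t <= C * (1 + t) ^+ m) ->
  0 <= c -> 1 <= lam -> 0 < del ->
  exists2 s, c < s & v (lam * s) <= (1 + del) * lam ^+ m * v (s - c).
Proof.
move=> vmono v1 vC c0 lam1 del0; apply: contrapT => nex.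
have {}nex s : c < s -> (1 + del) * lam ^+ m * v (s - c) < v (lam * s).
  by move=> cs; rewrite ltNge; apply/negP => h; apply: nex; exists s.
pose p2 : R := 2 ^+ m; have p2ge : 1 <= p2 by rewrite exprn_ege1 ?ler1n.
(* [e] is a relative slack small enough that (1 + e)^m stays below 1 + del. *)
have [e [e0 e1 he]] : exists e : R, [/\ 0 < e, e <= 1 & p2 * e <= del].
  exists (Num.min 1 (del / p2)); split.
  - by rewrite lt_min ltr01 divr_gt0// (lt_le_trans _ p2ge).
  - by rewrite ge_min lexx.
  - by rewrite mulrC -ler_pdivlMr ?ge_min ?lexx ?orbT// (lt_le_trans _ p2ge).
have he' : (1 + e) ^+ m < 1 + del.
  have := @expr_1D_ub _ m e; rewrite (ltW e0) e1 => /(_ isT) h.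
  apply: le_lt_trans h _; rewrite -/p2; lra.
(* From [t0] on the shift by [c] is absorbed by the slack: (1 + e) t - c >= t. *)
pose t0 := c / e + 1; have t01 : 1 <= t0.
  by rewrite /t0 lerDr divr_ge0// ltW.
have ect0 : c < e * t0.
  by rewrite /t0 mulrDr mulrCA divff ?gt_eqF//; lra.
pose L := lam * (1 + e); have L1 : 1 <= L by rewrite /L; nra.
have step t : t0 <= t -> (1 + del) * lam ^+ m * v t <= v (L * t).
  move=> tt0; have h : c <= e * t.
    by apply: le_trans (ltW ect0) _; rewrite ler_pM2l.
  have cs : c < (1 + e) * t by nra.
  rewrite /L -[lam * _ * t]mulrA; apply: (le_trans _ (ltW (nex _ cs))).
  rewrite ler_pM2l; last first.
    by rewrite mulr_gt0 ?exprn_gt0//; lra.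
  apply: vmono; lra.
pose K := (1 + del) * lam ^+ m.
have K0 : 0 < K by rewrite mulr_gt0 ?exprn_gt0//; lra.
have iterj j : K ^+ j <= v (L ^+ j * t0).
  elim: j => [|j IH]; first by rewrite expr0 mul1r v1//; lra.
  have Lj1 : 1 <= L ^+ j by rewrite exprn_ege1.
  rewrite !exprS -mulrA; apply: (le_trans _ (step _ _)); first by rewrite ler_pM2l.
  by rewrite ler_peMl//; lra.
have C0 : 0 <= C.
  have := vC 1 ler01 => /(le_trans (v1 _ ltr01)) h.
  have : 0 < C * (1 + 1) ^+ m by lra.
  by rewrite pmulr_lgt0 ?exprn_gt0 ?addr_gt0// => /ltW.
pose g := (1 + del) / (1 + e) ^+ m.
have em0 : 0 < (1 + e) ^+ m by rewrite exprn_gt0//; lra.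
have g1 : 1 < g by rewrite /g ltr_pdivlMr ?mul1r.
(* Each dilation by [L] multiplies [v] by at least [K], while the polynomial bound only allows a
   factor L^m up to a constant. As [g] is K / L^m > 1, some power of it exceeds that constant C (2
   t0)^m. *)
have [j] := expr_unbounded (C * (2 * t0) ^+ m) g1.
apply/negP; rewrite -leNgt.
have Lj1 : 1 <= L ^+ j by rewrite exprn_ege1.
have L0 : 0 < L by lra.
rewrite -(@ler_pM2r _ ((L ^+ m) ^+ j)); last by rewrite !exprn_gt0.
have -> : g ^+ j * (L ^+ m) ^+ j = K ^+ j.
  rewrite -exprMn; congr (_ ^+ _); rewrite /g /L /K exprMn.
  by field; rewrite gt_eqF.
apply: le_trans (iterj j) _; apply: le_trans (vC _ _) _; first by nra.
rewrite -mulrA ler_wpM2l//.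
rewrite -exprM mulnC exprM -exprMn lerXn2r ?nnegrE//; nra.
Qed.

(** * Lattice points in balls of a norm, and fractional coverings *)

Section lattice.
Variables (R : realType) (m : nat) (nu : 'rV[R]_m -> R).
Hypothesis nuN : is_norm nu.

Lemma is_norm_ge0 v : 0 <= nu v.
Proof.
case: nuN => tri hom _.
have n0 : nu 0 = 0 by rewrite -(scale0r 0) hom normr0 mul0r.
have : nu (v + - v) <= nu v + nu (- v) by exact: tri.
by rewrite subrr n0 -scaleN1r hom normrN1 mul1r; lra.
Qed.

Lemma is_norm_distC u v : nu (u - v) = nu (v - u).
Proof.
by case: nuN => _ hom _; rewrite -[LHS]mul1r -(normrN1 R) -hom scaleN1r opprB.
Qed.

Lemma is_norm_ub : exists2 C, 0 < C & forall v, nu v <= C * `|v|.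
Proof.
case: nuN => tri hom _.
exists (1 + \sum_j nu (delta_mx 0 j)).
  by rewrite ltr_wpDr// sumr_ge0// => j _; exact: is_norm_ge0.
move=> v; rewrite mulrDl mul1r.
apply: (@le_trans _ _ (\sum_j nu (v 0 j *: delta_mx 0 j))).
  rewrite {1}(row_sum_delta v).
  elim/big_rec2: _ => [|j y1 y2 _ h].
    by rewrite -(scale0r 0) hom normr0 mul0r.
  by apply: le_trans (tri _ _) _; rewrite lerD2l.
rewrite mulr_suml ler_wpDl//; apply: ler_sum => j _.
rewrite hom mulrC ler_wpM2l ?is_norm_ge0//.
rewrite [leRHS]/Num.Def.normr/= mx_normrE.
by apply/bigmax_geP; right; exists (0, j).
Qed.

(** Equivalence of norms: [nu] is continuous and attains a positive minimum on the compact unit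
    sphere of the sup norm. *)
Lemma is_norm_lb : exists2 C, 0 < C & forall v, `|v| <= C * nu v.
Proof.
case: (nuN) => tri hom def.
(* Without a nonzero vector, as for m = 0, the sphere is empty and has no minimum to offer. *)
have [[v0 v0n]|all0] := pselect (exists v : 'rV[R]_m, v != 0); last first.
  exists 1 => // v; have -> : v = 0.
    by apply/eqP; apply: contrapT => /negP h; apply: all0; exists v.
  by rewrite normr0 mul1r is_norm_ge0.
have [C C0 HC] := is_norm_ub.
have cont : continuous nu.
  move=> x; have FFx := nbhs_filter x; apply/cvgrPdist_lt => e e0.
  have : \forall y \near x, `|x - y| < e / C.
    by apply/nbhs_normP; exists (e / C) => //=; exact: divr_gt0.
  apply: filterS => y xy.
  have lip : `|nu x - nu y| <= C * `|x - y|.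
    rewrite ler_norml; apply/andP; split.
      have := tri x (y - x); rewrite addrC subrK is_norm_distC => h.
      have := HC (x - y); lra.
    have := tri y (x - y); rewrite addrC subrK => h.
    have := HC (x - y); lra.
  by apply: le_lt_trans lip _; rewrite mulrC -ltr_pdivlMr.
pose A := [set v : 'rV[R]_m | `|v| = 1].
have A0 : A !=set0.
  exists (`|v0|^-1 *: v0); rewrite /A /= normrZ normfV normr_id mulVf//.
  by rewrite normr_eq0.
have cA : compact A.
  apply: bounded_closed_compact.
    by exists 1; split=> // M M1 v /= ->; exact: ltW.
  have -> : A = (fun v : 'rV[R]_m => `|v|) @^-1` [set 1] by [].
  apply: closed_comp; last exact: closed_eq.
  by move=> x _; exact: norm_continuous.
have [|c] := @EVT_min_rV R m nu A A0 cA.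
  by apply: continuous_subspaceT => x; exact: cont.
rewrite inE => Ac cmin.
have nuc0 : 0 < nu c.
  rewrite lt_neqAle is_norm_ge0 andbT eq_sym; apply/eqP => /def c0.
  by move: Ac; rewrite /A /= c0 normr0 => /eqP; rewrite eq_sym oner_eq0.
exists (nu c)^-1; first by rewrite invr_gt0.
move=> v; have [->|vn] := eqVneq v 0.
  by rewrite normr0 mulr_ge0 ?is_norm_ge0// invr_ge0 ltW.
have := cmin (`|v|^-1 *: v); rewrite inE /A /= normrZ normfV normr_id.
have nv : 0 < `|v| by rewrite normr_gt0.
rewrite mulVf ?gt_eqF// => /(_ erefl).
rewrite hom normfV normr_id ler_pdivlMl// => h.
by rewrite ler_pdivlMl//; lra.
Qed.

Definition lattice_pt (z : 'rV[int]_m) : 'rV[R]_m := map_mx intr z.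

Lemma lattice_ptD : {morph lattice_pt : x y / x + y}.
Proof. by move=> x y; rewrite /lattice_pt map_mxD. Qed.

Lemma lattice_pt_inj : injective lattice_pt.
Proof.
move=> x y /rowP h; apply/rowP => j.
by have := h j; rewrite !mxE => /intr_inj.
Qed.

Definition lattice_ball (t : R) : set 'rV[int]_m :=
  [set z | nu (lattice_pt z) < t].

(** The shift by [N] makes the finite functions enumerate the integer points of the cube
    [-N, N]^m. *)
Definition window_pt (N : nat) (f : {ffun 'I_m -> 'I_(2 * N).+1}) : 'rV[int]_m :=
  \row_j ((f j : nat)%:Z - N%:Z).

Definition window (N : nat) : {fset 'rV[int]_m} :=
  [fset @window_pt N f | f in {: {ffun 'I_m -> 'I_(2 * N).+1}}]%fset.

Lemma window_card N : (#|` window N| <= (2 * N).+1 ^ m)%N.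
Proof.
apply: leq_trans (leq_imfset_card _ _ _) _.
by rewrite /= -cardE card_ffun !card_ord.
Qed.

Lemma mem_window N (z : 'rV[int]_m) :
  (forall j, `|z ord0 j| <= N%:Z) -> z \in window N.
Proof.
move=> h; apply/imfsetP => /=.
have b (j : 'I_m) : (absz (z ord0 j + N%:Z)%R < (2 * N).+1)%N.
  by have := h j; rewrite [ord0]ord1 ler_norml => /andP[]; lia.
exists [ffun j => Ordinal (b j)]; first by [].
apply/rowP => j; rewrite !mxE ffunE /=.
by have := h j; rewrite [ord0]ord1 ler_norml => /andP[]; lia.
Qed.

Lemma lattice_ball_window : exists2 C : R, 0 < C &
  forall t, 0 <= t -> lattice_ball t `<=` [set` window (Num.truncn (C * t))].
Proof.
have [C C0 HC] := is_norm_lb; exists C => // t t0 z /= zt.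
apply: mem_window => j.
have le1 : `|(z 0 j)%:~R| <= `|lattice_pt z|.
  rewrite [leRHS]/Num.Def.normr/= mx_normrE.
  by apply/bigmax_geP; right; exists (0, j) => //=; rewrite mxE.
have : `|(z 0 j)%:~R : R| < C * t.
  by apply: le_lt_trans le1 _; apply: le_lt_trans (HC _) _; rewrite ltr_pM2l.
move=> h2; rewrite -abszE lez_nat truncn_ge_nat; last by rewrite mulr_ge0// ltW.
by rewrite natr_absz intr_norm ltW.
Qed.

Lemma lattice_ball_finite t : finite_set (lattice_ball t).
Proof.
have [t0|t0] := leP 0 t.
  by have [C _ /(_ t t0) /sub_finite_set] := lattice_ball_window; apply.
apply: (@sub_finite_set _ _ set0) => // z /= h.
by have := is_norm_ge0 (lattice_pt z); move: h; rewrite /lattice_ball/=; lra.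
Qed.

Definition lattice_count (t : R) : nat := #|` fset_set (lattice_ball t)|.

(** By equivalence of norms the ball lies in a cube of side proportional to [t], whose integer
    points are counted directly. *)
Lemma lattice_count_ub : exists C : R,
  forall t, 0 <= t -> (lattice_count t)%:R <= C * (1 + t) ^+ m.
Proof.
have [C C0 HC] := lattice_ball_window.
exists ((2 * C + 1) ^+ m) => t t0.
have /fsubset_leq_card : (fset_set (lattice_ball t)
    `<=` window (Num.truncn (C * t)))%fset.
  apply/fsubsetP => z; rewrite in_fset_set ?inE; last exact: lattice_ball_finite.
  exact: HC.
rewrite -/(lattice_count t) => /leq_trans/(_ (window_card _)).
rewrite -(ler_nat R) => /le_trans; apply.
rewrite natrX -exprMn lerXn2r ?nnegrE//; first by nra.
have : (Num.truncn (C * t))%:R <= C * t by rewrite truncn_le// mulr_ge0// ltW.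
rewrite -natr1 natrM; nra.
Qed.

(** [U] is a discrete stand-in for the uniform measure on the ball of radius D + r. The ball of
    radius [r] around any point of the D-ball lies inside it, and so carries about the fraction (r /
    (D + r))^m of its mass. *)
Lemma fractional_covering (D r del : R) : 0 <= D -> 0 < r -> 0 < del ->
  exists (U : seq 'rV[R]_m) (w : nat), [/\ (0 < w)%N,
    (size U)%:R <= (1 + del) * ((D + r) / r) ^+ m * w%:R
    & forall p, nu p <= D -> (w <= count (fun u => nu (p - u)%R < r)%R U)%N].
Proof.
move=> D0 r0 del0; case: (nuN) => tri hom _.
have [C HC] := lattice_count_ub.
have [c' c'0 Hc'] := is_norm_ub.
have lam1 : 1 <= (D + r) / r by rewrite ler_pdivlMr//; lra.
have mono : {homo (fun t => (lattice_count t)%:R : R) : x y / x <= y}.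
  move=> x y xy; rewrite ler_nat fsubset_leq_card//; apply/fsubsetP => z.
  rewrite !in_fset_set ?inE; try exact: lattice_ball_finite.
  by rewrite /lattice_ball/= => /lt_le_trans; apply.
have ge1 t : 0 < t -> 1 <= (lattice_count t)%:R :> R.
  move=> t0; rewrite ler1n cardfs_gt0; apply/fset0Pn; exists 0.
  rewrite in_fset_set ?inE; last exact: lattice_ball_finite.
  rewrite /lattice_ball/= /lattice_pt map_mx0.
  by rewrite -(scale0r 0) hom normr0 mul0r.
(* [s'] is the radius [r] measured in lattice units, and [c'] bounds the error of rounding a point
   to the lattice. *)
have [s' cs' Hs'] := polynomial_growth_ratio mono ge1 HC (ltW c'0) lam1 del0.
pose s := s' / r; have s0 : 0 < s by rewrite divr_gt0// (lt_trans c'0).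
have s'E : s' = s * r by rewrite /s divfK// gt_eqF.
pose U := [seq s^-1 *: lattice_pt z |
  z <- fset_set (lattice_ball ((D + r) / r * s'))].
exists U, (lattice_count (s' - c')); split.
- by rewrite -(ler1n R) ge1// subr_gt0.
- by rewrite size_map.
move=> p pD; rewrite -size_filter.
(* Translating by the rounded point [fl] carries the lattice points of norm below s' - c'
   injectively to lattice points within s' of s p, so at least that many are near p. *)
pose fl : 'rV[int]_m := map_mx Num.floor (s *: p).
have flP : nu (s *: p - lattice_pt fl) <= c'.
  apply: le_trans (Hc' _) _; apply: ler_piMr; first exact: ltW.
  rewrite [leLHS]/Num.Def.normr/= mx_normrE; apply/bigmax_leP; split => // -[i j] _ /=.
  rewrite !mxE.
  have := floor_itv (s * p i j); set f := Num.floor _.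
  by rewrite intrD => /andP[h1 h2]; rewrite ger0_norm; lra.
rewrite /lattice_count -(size_map (fun z => s^-1 *: lattice_pt (z + fl))).
apply: uniq_leq_size.
  rewrite map_inj_uniq ?fset_uniq// => x y.
  move/(scalerI (invr_neq0 (lt0r_neq0 s0)))/lattice_pt_inj; exact: addIr.
move=> _ /mapP[z + ->].
rewrite in_fset_set ?inE; last exact: lattice_ball_finite.
rewrite /lattice_ball/= => zs.
have near_sp : nu (s *: p - lattice_pt (z + fl)) < s'.
  rewrite lattice_ptD opprD addrCA addrC.
  apply: le_lt_trans (tri _ _) _.
  have -> : nu (- lattice_pt z) = nu (lattice_pt z).
    by rewrite -scaleN1r hom normrN1 mul1r.
  lra.
rewrite mem_filter; apply/andP; split.
  have -> : p - s^-1 *: lattice_pt (z + fl)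
      = s^-1 *: (s *: p - lattice_pt (z + fl)).
    by rewrite scalerBr scalerA mulVf ?gt_eqF// scale1r.
  by rewrite hom gtr0_norm ?invr_gt0// ltr_pdivrMl// -s'E.
apply: map_f; rewrite in_fset_set ?inE; last exact: lattice_ball_finite.
rewrite /lattice_ball/=.
have -> : lattice_pt (z + fl) = (lattice_pt (z + fl) - s *: p) + s *: p.
  by rewrite subrK.
apply: le_lt_trans (tri _ _) _; rewrite is_norm_distC hom gtr0_norm//.
have : s * nu p <= s * D by rewrite ler_pM2l.
have -> : (D + r) / r * s' = s * D + s'.
  by rewrite s'E; field; rewrite gt_eqF.
lra.
Qed.

End lattice.

(** * Real and complex scalars, and norms with real values *)

Definition of_real (R : realType) (k : scalars) : R -> scalar_field R k :=
  match k return R -> scalar_field R k with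
  | RealScalars => id
  | ComplexScalars => fun x => x%:C%C
  end.

Section scalar_norm.
Variables (R : realType) (k : scalars).
Local Notation K := (scalar_field R k).
Local Notation ofR := (@of_real R k).

Lemma of_realD : {morph ofR : a b / a + b}.
Proof. by rewrite /of_real; case: k => // a b; rewrite rmorphD. Qed.

Lemma of_realM : {morph ofR : a b / a * b}.
Proof. by rewrite /of_real; case: k => // a b; rewrite rmorphM. Qed.

Lemma of_real_inj : injective ofR.
Proof. by rewrite /of_real; case: k => // a b [->]. Qed.

Lemma of_real0 : ofR 0 = 0.
Proof. by rewrite /of_real; case: k. Qed.

Lemma ler_of_real : {mono ofR : a b / a <= b}.
Proof. by rewrite /of_real; case: k => // a b; rewrite lecR. Qed.

Lemma scalar_reK (x : K) : 0 <= x -> ofR (scalar_re x) = x.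
Proof.
rewrite /of_real /scalar_re; case: k x => //= -[a b] /[dup] /ger0_Im /= ->.
by [].
Qed.

Lemma ler_scalar_re (x y : K) : x <= y -> scalar_re x <= scalar_re y.
Proof. by rewrite /scalar_re; case: k x y => // x y; rewrite lecE => /andP[]. Qed.

Lemma normr_of_real a : scalar_re `|ofR a| = `|a|.
Proof.
rewrite /of_real /scalar_re; case: k => //=.
by rewrite expr0n addr0 sqrtr_sqr.
Qed.

Section rnorm_theory.
Variable E : normedModType K.
Implicit Types x y : E.

(** Norm axioms pass to [rnorm] through this identity, since [of_real] is injective and preserves
    the order. *)
Lemma rnormE x : ofR (rnorm x) = `|x|.
Proof. by rewrite scalar_reK. Qed.

Lemma rnorm_ge0 x : 0 <= rnorm x.
Proof. by rewrite -ler_of_real rnormE of_real0. Qed.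

Lemma rnormD x y : rnorm (x + y) <= rnorm x + rnorm y.
Proof. by rewrite -ler_of_real of_realD !rnormE ler_normD. Qed.

Lemma rnormZ (c : K) x : rnorm (c *: x) = scalar_re `|c| * rnorm x.
Proof.
by apply: of_real_inj; rewrite of_realM !rnormE normrZ scalar_reK.
Qed.

Lemma rnorm0_eq0 x : rnorm x = 0 -> x = 0.
Proof.
by move=> /(congr1 ofR); rewrite rnormE of_real0 => /eqP; rewrite normr_eq0 => /eqP.
Qed.

Lemma rnorm0 : rnorm (0 : E) = 0.
Proof. by apply: of_real_inj; rewrite rnormE normr0 of_real0. Qed.

Lemma rdistC x y : rnorm (x - y) = rnorm (y - x).
Proof. by apply: of_real_inj; rewrite !rnormE distrC. Qed.

End rnorm_theory.

End scalar_norm.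

(** Over the complex numbers the 2n real coordinates are read as a 2 x n matrix: first row real
    parts, last row imaginary parts. *)
Definition real_coords (R : realType) (k : scalars) (n : nat) :
    'rV[R]_(real_dim k n) -> 'rV[scalar_field R k]_n :=
  match k return 'rV[R]_(real_dim k n) -> 'rV[scalar_field R k]_n with
  | RealScalars => id
  | ComplexScalars => fun v => \row_j ((vec_mx v ord0 j) +i* (vec_mx v ord_max j))%C
  end.

Section real_coords.
Variables (R : realType) (k : scalars) (n : nat).
Local Notation K := (scalar_field R k).
Local Notation rc := (@real_coords R k n).

Lemma real_coordsD : {morph rc : u v / u + v}.
Proof.
rewrite /real_coords; case: k => // u v.
by apply/rowP => j; rewrite linearD !mxE.
Qed.

Lemma real_coordsZ a v : rc (a *: v) = of_real k a *: rc v.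
Proof.
rewrite /real_coords /of_real; case: k v => // v.
by apply/rowP => j; rewrite linearZ !mxE; apply/eqP; rewrite eq_complex /= !mul0r subr0 addr0 !eqxx.
Qed.

Lemma real_coords_surj w : exists v, rc v = w.
Proof.
rewrite /real_coords; case: k w => w; first by exists w.
exists (mxvec (\matrix_(i < 2, j < n)
  if i == ord0 then complex.Re (w ord0 j) else complex.Im (w ord0 j))).
by apply/rowP => j; rewrite mxvecK !mxE /=; case: (w 0 j).
Qed.

Lemma real_coords_ub v i : scalar_re `|rc v 0 i| <= 2 * `|v|.
Proof.
have le1 m (u : 'rV[R]_m) j : `|u 0 j| <= `|u|.
  rewrite [leRHS]/Num.Def.normr/= mx_normrE.
  by apply/bigmax_geP; right; exists (0, j).
rewrite /real_coords /scalar_re; case: k v i => v i.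
  by apply: le_trans (le1 _ _ _) _; have := normr_ge0 v; lra.
rewrite !mxE.
set a := v 0 _; set b := v 0 _ => /=.
have ha : `|a| <= `|v| by exact: le1.
have hb : `|b| <= `|v| by exact: le1.
have v0 := normr_ge0 v.
rewrite -[leRHS]ger0_norm ?mulr_ge0// -sqrtr_sqr ler_wsqrtr//.
rewrite -(real_normK (num_real a)) -(real_normK (num_real b)).
have := normr_ge0 a; have := normr_ge0 b; nra.
Qed.

Variable E : normedModType K.

(** Pulls the norm of [E] back to real coordinates, so that the lattice results apply to it. *)
Lemma real_coords_rnorm (L' : 'rV[K]_n -> E) :
  linear L' -> injective L' -> is_norm (fun v => rnorm (L' (rc v))).
Proof.
move=> lin inj.
have linD x y : L' (x + y) = L' x + L' y.
  by have := lin 1 x y; rewrite !scale1r.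
have lin0 : L' 0 = 0.
  by apply: (addrI (L' 0)); rewrite -linD !addr0.
have linZ a x : L' (a *: x) = a *: L' x.
  by have := lin a x 0; rewrite lin0 !addr0.
split=> [u v|a v|v].
- by rewrite real_coordsD linD rnormD.
- by rewrite real_coordsZ linZ rnormZ normr_of_real.
- move=> /rnorm0_eq0; rewrite -lin0 => /inj.
  move: v; rewrite /real_coords; case: (k) => // v /rowP h.
  rewrite -[v]vec_mxK; apply/eqP; rewrite mxvec_eq0; apply/eqP/matrixP => i j.
  have := h j; rewrite !mxE => -[a0 b0].
  have [->|->] // : i = ord0 \/ i = ord_max.
  by case: i => [[|[|//]] ?]; [left|right]; exact: val_inj.
Qed.

End real_coords.

(** * Finite-dimensional normed spaces over either field *)

Section finite_dimension.
Variables (R : realType) (k : scalars) (n : nat).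
Local Notation K := (scalar_field R k).
Variable E : normedModType K.

Lemma has_dim_inv : has_dim E n -> exists (L : {linear E -> 'rV[K]_n})
  (L' : 'rV[K]_n -> E), cancel L L' /\ cancel L' L.
Proof. by move=> [L [L' h1 h2]]; exists L, L'. Qed.

(** The real result is applied to the pulled-back norm; over the complex numbers this doubles the
    exponent. *)
Lemma fractional_covering_normed (D r del : R) : has_dim E n ->
  0 <= D -> 0 < r -> 0 < del ->
  exists (U : seq E) (w : nat), [/\ (0 < w)%N,
    (size U)%:R <= (1 + del) * ((D + r) / r) ^+ real_dim k n * w%:R
    & forall p, rnorm p <= D -> (w <= count (fun u => rnorm (p - u)%R < r)%R U)%N].
Proof.
move=> /has_dim_inv[L [L' [LL' L'L]]] D0 r0 del0.
have lin : linear L' by exact: (can2_linear LL' L'L).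
have N := real_coords_rnorm lin (can_inj L'L).
have [U [w [w0 sU HU]]] := fractional_covering N D0 r0 del0.
exists [seq L' (real_coords u) | u <- U], w; split=> //.
  by rewrite size_map.
move=> p pD; have [v vp] := real_coords_surj (L p).
have pE : p = L' (real_coords v) by rewrite vp LL'.
rewrite count_map; apply: leq_trans (HU v _) _; first by rewrite -pE.
apply: sub_count => u /=; rewrite pE.
have -> // : L' (real_coords (v - u)) = L' (real_coords v) - L' (real_coords u).
have -> : real_coords (v - u) = (-1) *: real_coords u + real_coords v.
  rewrite addrC real_coordsD; congr (_ + _).
  rewrite -scaleN1r real_coordsZ; congr (_ *: _).
  by rewrite /of_real; case: (k) => //; rewrite rmorphN1.
by rewrite lin scaleN1r addrC.
Qed.

(** For a unit vector [e0] and r = |L' e0|, testing L' on [e0] gives norm at least r, and testing L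
    on L' e0 / r gives norm at least 1 / r. *)
Lemma banach_mazur_l2_ge1 : (0 < n)%N -> has_dim E n -> 1 <= banach_mazur_l2 E n.
Proof.
move=> n0 /has_dim_inv[L0 [L0' [h h']]].
apply: lb_le_inf; first by eexists; exists L0, L0'.
move=> _ [L [L' [LL' L'L ->]]] {L0 L0' h h'}.
have lin : linear L' by exact: (can2_linear LL' L'L).
have N := real_coords_rnorm lin (can_inj L'L).
have re_ge0 (c : K) : 0 <= scalar_re `|c|.
  by rewrite -(@ler_of_real R k) scalar_reK// of_real0.
have [C C0 HC] := is_norm_lb N.
(* Boundedness of both sets is what makes each [sup] in [op_norm] a genuine upper bound. *)
have ubL : has_ubound [set l2norm (L x) | x in [set x : E | rnorm x <= 1]].
  exists (Num.sqrt (\sum_(i < n) (2 * C) ^+ 2)) => _ [x /= x1 <-].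
  rewrite /l2norm ler_wsqrtr//; apply: ler_sum => i _.
  have [v vp] := real_coords_surj (L x).
  rewrite lerXn2r ?nnegrE//; first by rewrite mulr_ge0// ltW.
  rewrite -vp; apply: le_trans (real_coords_ub _ _) _.
  rewrite ler_pM2l//; apply: le_trans (HC v) _.
  by rewrite vp LL' ler_piMr// ltW.
have ubL' : has_ubound [set rnorm (L' w) | w in [set w : 'rV[K]_n | l2norm w <= 1]].
  exists (\sum_j rnorm (L' (delta_mx 0 j))) => _ [w /= w1 <-].
  have wj j : scalar_re `|w 0 j| <= 1.
    rewrite -[leLHS]ger0_norm// -sqrtr_sqr; apply: le_trans w1.
    rewrite ler_wsqrtr// (bigD1 j)//= lerDl sumr_ge0// => i _; exact: sqr_ge0.
  rewrite {1}(row_sum_delta w).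
  elim/big_rec2: _ => [|j y1 y2 _ h].
    have := lin (-1) 0 0; rewrite scaler0 addr0 scaleN1r addNr => ->.
    by rewrite rnorm0.
  rewrite lin; apply: le_trans (rnormD _ _) _; rewrite lerD// rnormZ.
  by rewrite ler_piMl// rnorm_ge0.
pose e0 : 'rV[K]_n := delta_mx 0 (Ordinal n0).
have l2e a : l2norm (of_real k a *: e0) = `|a|.
  rewrite /l2norm (bigD1 (Ordinal n0))//= big1 => [|i ni].
    by rewrite !mxE !eqxx mulr1 normr_of_real addr0 sqrtr_sqr normr_id.
  rewrite !mxE (negbTE ni) andbF mulr0 -(@of_real0 R k) normr_of_real normr0.
  by rewrite expr0n.
have l2e1 : l2norm e0 = 1.
  rewrite -[e0]scale1r -[1 in LHS](_ : of_real k 1 = _) ?l2e ?normr1//.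
  by rewrite /of_real; case: (k).
have e00 : e0 != 0.
  apply/eqP => e00; have := l2e 0.
  by rewrite of_real0 scale0r normr0 -e00 l2e1 => /eqP; rewrite oner_eq0.
pose r := rnorm (L' e0).
have r0 : 0 < r.
  rewrite lt_neqAle rnorm_ge0 andbT eq_sym; apply/eqP => /rnorm0_eq0 h.
  by move: e00; rewrite -(L'L e0) h linear0 eqxx.
have hL' : r <= op_norm (@l2norm R k n) (@rnorm R k E) L'.
  by apply: ub_le_sup => //; exists e0 => //=; rewrite l2e1.
have hL : r^-1 <= op_norm (@rnorm R k E) (@l2norm R k n) L.
  apply: ub_le_sup => //; exists (of_real k r^-1 *: L' e0) => /=.
    by rewrite rnormZ normr_of_real gtr0_norm ?invr_gt0// mulVf// gt_eqF.
  by rewrite linearZ /= L'L l2e gtr0_norm ?invr_gt0.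
rewrite -(mulVf (lt0r_neq0 r0)) ler_pM// ?invr_ge0; exact: ltW.
Qed.

End finite_dimension.

(** * Distances and bounded sets in [V] *)

Section dist.
Variables (R : realType) (k : scalars) (X : normedModType (scalar_field R k)).
Variable V : set X.

Lemma distxx (x : V) : dist x x = 0.
Proof. by rewrite /dist subrr rnorm0. Qed.

Lemma dist_sym (x y : V) : dist x y = dist y x.
Proof. exact: rdistC. Qed.

End dist.

Lemma bounded_set_dist (R : realType) (k : scalars)
    (X : normedModType (scalar_field R k)) (V : set X) (B : set V) :
  bounded_set (val @` B) ->
  exists2 d : R, 0 < d & forall x y, B x -> B y -> dist x y <= d.
Proof.
move=> [M [_ /(_ (M + 1))]]; rewrite ltrDl ltr01 => /(_ isT) hM.
have h x : B x -> rnorm (val x) <= scalar_re (M + 1).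
  by move=> Bx; apply/ler_scalar_re/hM; exists x.
(* [M] is a scalar of the field, hence the real part; the final + 1 keeps the diameter bound
   positive. *)
exists (2 * `|scalar_re (M + 1)| + 1).
  by rewrite ltr_wpDl// mulr_ge0.
move=> x y Bx By; rewrite /dist; apply: le_trans (rnormD _ _) _.
have -> : rnorm (- val y) = rnorm (val y) by rewrite -sub0r rdistC subr0.
have := h _ Bx; have := h _ By; have := ler_norm (scalar_re (M + 1)); lra.
Qed.

(** * Size of sets separated by an iterate *)

Definition separated (R : realType) (k : scalars)
    (X : normedModType (scalar_field R k)) (V : set X) (B : set V)
    (g : V -> V) (e : R) (E : seq V) : Prop :=
  [/\ uniq E, forall x, x \in E -> B x
    & forall x y, x \in E -> y \in E -> x != y -> e < dist (g x) (g y)].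

Section separated_size.
Variables (R : realType) (k : scalars) (X : normedModType (scalar_field R k)).
Variables (V : set X) (B : set V) (f : V -> V).
Variables (Xn : normedModType (scalar_field R k)) (P : V -> Xn).
Variables (n : nat) (eta mu kappa sigma : R).
Hypotheses (dimXn : has_dim Xn n) (eta0 : 0 <= eta) (mu0 : 0 < mu).
Hypotheses (kappa0 : 0 < kappa) (sigma0 : 0 < sigma).
Hypothesis fB : forall x, B x -> B (f x).
Hypothesis contract : forall x y, B x -> B y ->
  dist (f x) (f y) <= eta * dist x y + mu * rnorm (P (f x) - P (f y)).
Hypothesis lipschitz : forall x y, B x -> B y ->
  rnorm (P (f x) - P (f y)) <= kappa * dist x y.

Lemma separated_size (j : nat) (d : R) (E : seq V) : 0 < d ->
  separated B (iter j f) ((eta + sigma) ^+ j * d) E ->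
  (forall x y, x \in E -> y \in E -> dist x y <= d) ->
  (size E)%:R <= ((1 + 2 * kappa * mu / sigma) ^+ real_dim k n) ^+ j.
Proof.
have q0 : 0 < eta + sigma by rewrite ltr_wpDl.
have c0 : 0 <= 2 * kappa * mu / sigma by rewrite !mulr_ge0 ?invr_ge0// ltW.
set H := (1 + _) ^+ _.
have H0 : 0 < H by rewrite exprn_gt0//; lra.
elim: j d E => [|j IH] d E d0 [uE EB sep] diam.
  (* Two distinct points would be both more than [d] and at most [d] apart. *)
  rewrite expr0; case: E uE EB sep diam => [|x [|y E]] //= /andP[+ _] _ sep diam.
  rewrite inE negb_or => /andP[xy _].
  have := sep x y; rewrite !inE !eqxx orbT => /(_ isT isT xy).
  by rewrite expr0 mul1r ltNge diam// !inE eqxx ?orbT.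
case E0 : E => [|x0 E']; first by rewrite ltW// exprn_gt0.
rewrite -E0.
have x0E : x0 \in E by rewrite E0 inE eqxx.
(* With this radius, P-images in a common r-ball are at most 2 r = sigma d / mu apart, which the
   factor [mu] turns into sigma d. *)
pose r := sigma * d / (2 * mu).
have r0 : 0 < r by rewrite !divr_gt0 ?mulr_gt0.
have D0 : 0 <= kappa * d by rewrite mulr_ge0// ltW.
pose p x := P (f x) - P (f x0).
have ratio : (kappa * d + r) / r = 1 + 2 * kappa * mu / sigma.
  by rewrite /r; field; rewrite !gt_eqF.
(* The fractional covering loses a factor 1 + del, removed by letting [del] tend to 0. *)
suff key del : 0 < del -> (size E)%:R <= (1 + del) * H ^+ j.+1.
  have Hj0 : 0 < H ^+ j.+1 by rewrite exprn_gt0.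
  apply/ler_addgt0Pr => e e0.
  have := key (e / H ^+ j.+1); rewrite divr_gt0// => /(_ isT) /le_trans; apply.
  by rewrite mulrDl mul1r divfK// gt_eqF.
move=> del0.
have [U [w [w0 sU HU]]] := fractional_covering_normed dimXn D0 r0 del0.
rewrite ratio -/H in sU.
pose nearby (u : Xn) (x : V) := rnorm (p x - u) < r.
have few u : (size ([seq x <- E | nearby u x]))%:R <= H ^+ j.
  have inF x : x \in [seq x <- E | nearby u x] -> nearby u x /\ x \in E.
    by rewrite mem_filter => /andP[].
  (* Points with equal images under [f] would not be separated by later iterates, so passing to the
     image keeps the count. *)
  have inj_f : {in [seq x <- E | nearby u x] &, injective f}.
    move=> x y /inF[_ xE] /inF[_ yE] fxy; apply: contrapT => /eqP xy.
    have := sep _ _ xE yE xy; rewrite !iterSr fxy distxx ltNge.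
    by rewrite mulr_ge0 ?exprn_ge0// ltW.
  (* The image has diameter at most q d and is separated by [j] iterates at scale q^j (q d), with q
     = eta + sigma. *)
  rewrite -(size_map f); apply: (IH ((eta + sigma) * d)).
  - by rewrite mulr_gt0.
  - split.
    + by rewrite map_inj_in_uniq// filter_uniq.
    + by move=> _ /mapP[x /inF[_ xE] ->]; apply/fB/EB.
    + move=> _ _ /mapP[x /inF[_ xE] ->] /mapP[y /inF[_ yE] ->] xy.
      rewrite mulrA -exprSr -!iterSr; apply: sep => //.
      by apply: contra_neq xy => ->.
  move=> _ _ /mapP[x /inF[nx xE] ->] /mapP[y /inF[ny yE] ->].
  apply: le_trans (contract (EB _ xE) (EB _ yE)) _.
  have close : rnorm (P (f x) - P (f y)) <= sigma * d / mu.
    have -> : P (f x) - P (f y) = (p x - u) + (u - p y).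
      by rewrite /p addrA subrK opprB addrA subrK.
    apply: le_trans (rnormD _ _) _; rewrite (rdistC u).
    have -> : sigma * d / mu = r + r by rewrite /r; field; rewrite gt_eqF.
    by rewrite lerD// ltW.
  rewrite mulrDl lerD//.
    by rewrite ler_wpM2l// diam.
  apply: (@le_trans _ _ (mu * (sigma * d / mu))); first by rewrite ler_pM2l.
  by rewrite mulrC divfK// gt_eqF.
(* Double counting of the pairs (x, u) with [nearby u x]: each [x] has at least [w] partners. *)
have dbl : (size E * w <= \sum_(u <- U) size ([seq x <- E | nearby u x]))%N.
  have -> : (size E * w = \sum_(x <- E) w)%N.
    by rewrite big_const_seq count_predT iter_addn_0 mulnC.
  apply: (@leq_trans (\sum_(x <- E) count (nearby^~ x) U)%N).
    rewrite big_seq [leqRHS]big_seq; apply: leq_sum => x xE; apply: HU.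
    apply: le_trans (lipschitz (EB _ xE) (EB _ x0E)) _.
    by rewrite ler_pM2l// diam.
  under eq_bigr do rewrite -sum1_count big_mkcond.
  rewrite exchange_big; apply: leq_sum => u _ /=.
  by rewrite size_filter -sum1_count [leqRHS]big_mkcond.
have w0R : 0 < w%:R :> R by rewrite ltr0n.
rewrite -(ler_pM2r w0R) -natrM.
apply: (@le_trans _ _ ((size U)%:R * H ^+ j)).
  apply: (@le_trans _ _ (\sum_(u <- U) size ([seq x <- E | nearby u x]))%:R).
    by rewrite ler_nat.
  rewrite natr_sum mulr_natl.
  apply: (@le_trans _ _ (\sum_(u <- U) H ^+ j)); first by apply: ler_sum.
  by rewrite big_const_seq count_predT iter_addr_0.
apply: le_trans (ler_wpM2r (ltW _) sU) _; first by rewrite exprn_gt0.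
by rewrite exprS; lra.
Qed.

End separated_size.

(** * From separated sets to covers, and the theorem *)

Lemma covering_number_separated (R : realType) (k : scalars)
    (X : normedModType (scalar_field R k)) (V : set X) (B : set V)
    (g : V -> V) (e eps H : R) : 0 <= e < eps ->
  (forall E, separated B g e E -> (size E)%:R <= H) ->
  (covering_number (g @` B) eps <= H%:E)%E.
Proof.
move=> /andP[e0 eeps] bnd.
pose Q m := `[< exists2 E, separated B g e E & size E = m >].
have Q0 : exists m, Q m by exists 0%N; apply/asboolP; exists [::].
have Qle m : Q m -> (m <= Num.truncn H)%N.
  move=> /asboolP[E sE <-]; rewrite truncn_ge_nat ?bnd//.
  by apply: le_trans (bnd _ sE).
(* A separated set of maximal size yields a net: a point whose image is missed by all the balls
   could be added to it. *)
case: (ex_maxnP Q0 Qle) => m /asboolP[E sE szE] mmax.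
have [uE EB sep] := sE.
have cov y : B y -> exists2 x, x \in E & dist (g x) (g y) < eps.
  move=> By; apply: contrapT => nex.
  have {}nex x : x \in E -> e < dist (g x) (g y).
    move=> xE; apply: lt_le_trans eeps _; rewrite leNgt; apply/negP => h.
    by apply: nex; exists x.
  have yE : y \notin E.
    by apply/negP => /nex; rewrite distxx ltNge e0.
  have := mmax m.+1; rewrite ltnn => h; suff: false by []; apply: h.
  apply/asboolP; exists (y :: E); last by rewrite /= szE.
  split=> [|x|x x'].
  - by rewrite /= yE.
  - by rewrite inE => /predU1P[->|/EB].
  - rewrite !inE => /predU1P[->|xE] /predU1P[->|x'E]; first by rewrite eqxx.
    + by move=> _; rewrite dist_sym nex.
    + by move=> _; exact: nex.
    + exact: sep.
apply: (@le_trans _ _ (m%:R%:E)); last by rewrite lee_fin -szE bnd.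
apply: ereal_inf_lbound; exists m => //.
exists (fun i => g (tnth (in_tuple E) (cast_ord (esym szE) i))); split.
  by move=> i; exists (tnth (in_tuple E) (cast_ord (esym szE) i)) => //; apply/EB/mem_tnth.
move=> _ [y By <-]; have [x xE xy] := cov y By.
have /tnthP[i xi] : x \in in_tuple E by [].
exists (cast_ord szE i) => //=.
by rewrite cast_ordK -xi.
Qed.

Lemma semigroup_iter (R : realType) (k : scalars)
    (X : normedModType (scalar_field R k)) (V : set X) (TT : set R)
    (S : R -> V -> V) (T : R) (j : nat) :
  time_set TT -> semigroup TT S -> TT T -> S (j%:R * T) =1 iter j (S T).
Proof.
move=> tTT [S0 SD] TTT.
(* The semigroup law is only available inside the time set, which contains the multiples of [T] in
   both cases. *)
have TTj i : TT (i%:R * T).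
  case: tTT TTT => -> /=; first by move=> T0; rewrite mulr_ge0.
  by move=> [l _ <-]; exists (i * l)%N => //; rewrite natrM.
elim: j => [|j IH] x; first by rewrite mul0r S0.
by rewrite iterS -IH SD// -natr1 mulrDl mul1r addrC.
Qed.

Theorem proposition6p4 (R : realType) (k : scalars)
  (X : normedModType (scalar_field R k)) (V : set X)
  (TT : set R) (S : R -> V -> V) (B : set V) (T : R)
  (Xn : normedModType (scalar_field R k)) (P : V -> Xn)
  (n : nat) (eta mu kappa : R) :
  V !=set0 ->
  time_set TT -> semigroup TT S ->
  B !=set0 -> bounded_set (val @` B) ->
  TT T -> 0 < T -> S T @` B `<=` B ->
  generalized_squeezing S B T P n eta mu kappa ->
  forall sigma : R, 0 < sigma < 1 - eta ->
  exists (k0 : nat) (a b h : R),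
    [/\ (0 < k0)%N, 0 < a, 0 < b, 1 <= h &
      (forall j : nat, (k0 <= j)%N ->
        (covering_number (S (j%:R * T)%R @` B) (a * (eta + sigma) ^+ j)%R
          <= (b * h ^+ j)%:E)%E) /\
      h <= (1 + 2 * kappa * mu * banach_mazur_l2 Xn n / sigma)
             ^+ real_dim k n].
Proof.
move=> _ tTT sg _ Bbd TTT _ SB [[n0 dimXn] /andP[eta0 eta1] mu0 kappa0 sq].
move=> sigma /andP[sigma0 _].
have [d d0 hd] := bounded_set_dist Bbd.
have q0 : 0 < eta + sigma by rewrite ltr_wpDl.
have c0 : 0 <= 2 * kappa * mu / sigma by rewrite !mulr_ge0 ?invr_ge0// ltW.
(* The radius 2 d q^j strictly exceeds the separation d q^j, as the open balls of the cover
   require. *)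
exists 1%N, (2 * d), 1, ((1 + 2 * kappa * mu / sigma) ^+ real_dim k n); split=> //.
- by rewrite mulr_gt0.
- by rewrite exprn_ege1// lerDl.
split=> [j _|].
  rewrite mul1r (_ : S (j%:R * T) = iter j (S T)); last first.
    by apply/funext => x; rewrite (semigroup_iter _ tTT sg TTT).
  have qj0 : 0 < (eta + sigma) ^+ j by rewrite exprn_gt0.
  apply: (@covering_number_separated _ _ _ _ _ _ ((eta + sigma) ^+ j * d)).
    by have := mulr_gt0 qj0 d0; lra.
  move=> E sE; have [_ EB _] := sE.
  apply: (separated_size dimXn eta0 mu0 kappa0 sigma0 _ _ _ d0 sE).
  - by move=> x Bx; apply: SB; exists x.
  - by move=> x y Bx By; exact: (sq x y Bx By).1.
  - by move=> x y Bx By; exact: (sq x y Bx By).2.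
  - by move=> x y /EB Bx /EB By; exact: hd.
(* The chosen [h] has 1 in place of the Banach-Mazur distance, so this bound gives the required
   inequality. *)
have bm1 := banach_mazur_l2_ge1 n0 dimXn.
rewrite lerXn2r ?nnegrE//; first by lra.
  rewrite addr_ge0// !mulr_ge0 ?invr_ge0 ?ltW//; lra.
rewrite lerD2l ler_pM2r ?invr_gt0// ler_peMr// ltW// !mulr_gt0//.
Qed.
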